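(* Let $(Q,\cdot)$ be a groupoid. Then $(Q,\cdot)$ is a pentagonal quasigroup if and only if on the set $Q$ one can define an Abelian group $(Q,+)$ and a regular automorphism $\varphi$ of $(Q,+)$ such that $$x\cdot y=\varphi(x)+(\varepsilon-\varphi)(y)\quad\text{for all }x,y\in Q,$$ and $$\varphi^4-\varphi^3+\varphi^2-\varphi+\varepsilon=0,$$ where $\varepsilon$ is the identity automorphism of $(Q,+)$.
   Context: A groupoid is a nonempty set with a binary operation $\cdot$ (also written as juxtaposition; juxtaposition binds more tightly than $\cdot$, so $xy\cdot zu=(xy)(zu)$). A quasigroup is a groupoid in which for all $a,b$ each of the equations $ax=b$ and $ya=b$ has a unique solution. A quasigroup is pentagonal if it satisfies the identities $xx=x$, $\;xy\cdot zu=xz\cdot yu$, and $(xy\cdot x)y\cdot x=y$, i.e. $\big(((xy)x)y\big)x=y$. An automorphism $\varphi$ of a group $(Q,+)$ is regular if $\varphi(x)=x$ holds only for $x=0$. Sums, powers and $0$ of endomorphisms of $(Q,+)$ are taken in the endomorphism ring of the Abelian group $(Q,+)$. *)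

(* Defs.v *)
From HB Require Import structures.
From mathcomp Require Import all_boot all_order all_algebra.

Set Implicit Arguments.
Unset Strict Implicit.
Unset Printing Implicit Defensive.

Import GRing.Theory.

(* A groupoid in the sense of a set with a binary operation is a [magmaType];
   its operation is written [(x * y)%g]. Nonemptiness is not part of
   [magmaType] and is a separate hypothesis. *)

Definition is_quasigroup (Q : magmaType) : Prop :=
  forall a b : Q,
    (exists! x : Q, (a * x)%g = b) /\ (exists! y : Q, (y * a)%g = b).

Definition is_pentagonal_quasigroup (Q : magmaType) : Prop :=
  [/\ is_quasigroup Q,
      forall x : Q, (x * x)%g = x,
      forall x y z u : Q, ((x * y) * (z * u))%g = ((x * z) * (y * u))%g
    & forall x y : Q, ((((x * y) * x) * y) * x)%g = y].

Definition is_automorphism (V : zmodType) (phi : {additive V -> V}) : Prop :=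
  bijective phi.

Definition regular_endo (V : zmodType) (phi : {additive V -> V}) : Prop :=
  forall x : V, phi x = x -> x = 0%R.

(* Main.v *)
Require Import Defs.
From HB Require Import structures.
From mathcomp Require Import all_boot all_order all_algebra.
From mathcomp Require Import boolp.

Set Implicit Arguments.
Unset Strict Implicit.
Unset Printing Implicit Defensive.

Import GRing.Theory.
Local Open Scope ring_scope.

(** The theorem splits into a structure theorem for idempotent medial
    quasigroups, and a computation that isolates the pentagonal law.

    Let [o] be any point of an idempotent medial quasigroup, and put
    [phi x = x * o], [psi y = o * y].  Both maps are bijective, so there is
    exactly one operation [+] with [x * y = phi x + psi y].  Mediality together
    with [o * o = o] makes [phi] and [psi] commuting endomorphisms of [*], hence
    of [+]; applying mediality to products in which some entries are [o] then
    gives commutativity and associativity of [+], while [o] is neutral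
    ([medial_idempotent_quasigroup_affine]).  Idempotence says
    [phi x + psi x = x], that is, [psi = id - phi].

    In such an affine quasigroup,
    [(((x * y) * x) * y) * x = p(phi)(x) + phi (id - phi) (id + phi^2) (y)] with
    [p(t) = t^4 - t^3 + t^2 - t + 1], and [t (1 - t) (1 + t^2) = 1 - p(t)]
    ([pentagonal_polyE], [sub_pentagonal_poly]).  So the pentagonal law
    amounts to [p(phi) = 0].  The same factorization shows that [p(phi) = 0]
    makes [id - phi] invertible with inverse [phi (id + phi^2)], which gives the
    solvability of [a * x = b] in the converse direction.  Regularity of [phi]
    is cancellation: [phi x = x] says [x * o = x = x * x], so [x = o]. *)

Lemma exists_unique_bijective (T U : Type) (f : T -> U) :
  (forall u, exists! t, f t = u) -> bijective f.
Proof.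
move=> f_uniq; have [g gP] := choice f_uniq.
exists g => [t|u]; first exact: (gP (f t)).2 _ erefl.
exact: (gP u).1.
Qed.

(** The idempotent case of the theorem of Toyoda and Bruck.  Each group axiom is
    checked on elements written as values of compositions of the translations
    [f = phi] and [g = psi]: these are surjective, and [f x + g y = x * y], so
    every sum becomes a product to which mediality applies. *)
Lemma medial_idempotent_quasigroup_affine (Q : magmaType) (o : Q) :
    is_quasigroup Q ->
    (forall x : Q, (x * x)%g = x) ->
    (forall x y z u : Q, ((x * y) * (z * u))%g = ((x * z) * (y * u))%g) ->
  exists (add_str : GRing.Zmodule Q),
    let V : zmodType := GRing.Zmodule.Pack add_str in
    exists phi psi : {additive V -> V},
      [/\ bijective phi, 0 = o :> V, forall x : V, phi x = (x * o)%g
        & forall x y : Q, (x * y)%g = phi x + psi y].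
Proof.
move=> quasiQ idem medial.
pose f (x : Q) : Q := (x * o)%g; pose g (y : Q) : Q := (o * y)%g.
have bij_f : bijective f.
  by apply: exists_unique_bijective => b; case: (quasiQ o b).
have bij_g : bijective g.
  by apply: exists_unique_bijective => b; case: (quasiQ o b).
case: (bij_f) => f' fK f'K; case: (bij_g) => g' gK g'K.
have fM x y : f (x * y)%g = (f x * f y)%g by rewrite /f -{1}(idem o) medial.
have gM x y : g (x * y)%g = (g x * g y)%g by rewrite /g -{1}(idem o) medial.
have fg x : f (g x) = g (f x) by rewrite /g fM {1}/f idem.
have fo : f o = o := idem o; have go : g o = o := idem o.
have f'o : f' o = o by rewrite -{1}fo fK.
pose add (x y : Q) : Q := (f' x * g' y)%g.
have addE x y : add (f x) (g y) = (x * y)%g by rewrite /add fK gK.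
have add_f x y : f (add x y) = add (f x) (f y).
  by rewrite -[x]f'K -[y]g'K addE fM fg addE.
have add_g x y : g (add x y) = add (g x) (g y).
  by rewrite -[x]f'K -[y]g'K addE gM -fg addE.
have addC : commutative add.
  move=> x y; rewrite -[x]f'K -[f' x]g'K -[y]g'K -[g' y]f'K.
  set a := g' _; set b := f' (g' y).
  by rewrite addE (fg a) -(fg b) addE; apply: medial.
have addA : associative add.
  move=> x y z.
  rewrite -[x]f'K -[f' x]f'K -[y]f'K -[f' y]g'K -[z]g'K -[g' z]g'K.
  set a := f' (f' x); set b := g' _; set c := g' (g' z).
  rewrite -(add_f (f a)) {1}(fg b) -(add_g (f b)) !addE.
  exact: (medial a o b c).
have add0 : left_id o add by move=> y; rewrite /add f'o -/(g _) g'K.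
have ex_opp (x : Q) : exists z, add z x = o.
  have [_ [w [wP _]]] := quasiQ (g' x) o.
  by exists (f w); rewrite /add fK.
have [opp oppP] := choice ex_opp.
(* The abelian group structure includes decidable equality and a choice
   operator, which a bare groupoid lacks; both are taken classically. *)
pose C : choiceType :=
  HB.pack_for choiceType Q (gen_eqMixin Q) (gen_choiceMixin Q).
pose V : zmodType := HB.pack_for zmodType Q (Choice.class C)
  (GRing.isZmodule.Build C addA addC add0 oppP).
exists (GRing.Zmodule.class V).
pose phi : {additive V -> V} :=
  HB.pack (f : V -> V) (GRing.isNmodMorphism.Build V V f (conj fo add_f)).
pose psi : {additive V -> V} :=
  HB.pack (g : V -> V) (GRing.isNmodMorphism.Build V V g (conj go add_g)).
by exists phi, psi; split.
Qed.

Definition pentagonal_poly (V : zmodType) (phi : V -> V) : V -> V :=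
  iter 4 phi \- iter 3 phi \+ iter 2 phi \- phi \+ idfun.

Lemma sub_pentagonal_poly (V : zmodType) (phi : V -> V) y :
  y - pentagonal_poly phi y
  = phi y - phi (phi y) + phi (phi (phi y)) - phi (phi (phi (phi y))).
Proof.
rewrite /pentagonal_poly /= opprD addrCA subrr addr0 !opprD !opprK.
by rewrite (ACl (4*3*2*1)).
Qed.

(** When [p(phi) = 0], the factorization [1 - p(t) = t (1 - t) (1 + t^2)]
    exhibits [phi (id + phi^2)] as a two-sided inverse of [id - phi]. *)
Lemma pentagonal_poly_inverse (V : zmodType) (phi : {additive V -> V}) :
    pentagonal_poly phi =1 \0 ->
  bijective (idfun \- phi).
Proof.
move=> p0; exists (fun y => phi (y + phi (phi y))) => y /=;
  rewrite -[RHS]subr0 -[X in _ = y - X](p0 y) sub_pentagonal_poly.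
  by rewrite !(raddfD, raddfN) /= addrA.
by rewrite !(raddfD, raddfN) /= (AC (2*2) ((1*3)*2*4)).
Qed.

(** The left-hand side is the pentagonal word [(((xy)x)y)x]; the right-hand side
    separates its dependence on [x] and on [y], so that either variable can be
    set to [0]. *)
Lemma pentagonal_polyE (V : zmodType) (phi : {additive V -> V}) x y :
  let mul u v := phi u + (idfun \- phi) v in
  mul (mul (mul (mul x y) x) y) x
  = pentagonal_poly phi x + (y - pentagonal_poly phi y).
Proof.
rewrite sub_pentagonal_poly /pentagonal_poly /= !(raddfD, raddfN) /=.
by rewrite (AC (1*2*2*2*2) ((1*5*4*9*8)*(6*7*2*3))).
Qed.

Lemma affine_quasigroup (Q : magmaType) (add_str : GRing.Zmodule Q) :
    let V : zmodType := GRing.Zmodule.Pack add_str in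
    forall phi psi : V -> V, bijective phi -> bijective psi ->
    (forall x y : Q, (x * y)%g = phi x + psi y) ->
  is_quasigroup Q.
Proof.
move=> V phi psi [phi' phiK phi'K] [psi' psiK psi'K] mulE a b.
split; [exists (psi' ((b : V) - phi a)) | exists (phi' ((b : V) - psi a))].
  split=> [|x <-]; rewrite mulE; first by rewrite psi'K addrC subrK.
  by rewrite [X in X - _]addrC addrK psiK.
split=> [|x <-]; rewrite mulE; first by rewrite phi'K subrK.
by rewrite addrK phiK.
Qed.

Theorem theorem2p1 (Q : magmaType) (Q_nonempty : inhabited Q) :
  is_pentagonal_quasigroup Q <->
  exists (add_str : GRing.Zmodule Q),
    let V : zmodType := GRing.Zmodule.Pack add_str in
    exists phi : {additive V -> V},
      [/\ is_automorphism phi,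
          regular_endo phi,
          forall x y : Q, (x * y)%g = phi x + (idfun \- phi) y
        & iter 4 phi \- iter 3 phi \+ iter 2 phi \- phi \+ idfun =1 \0].
Proof.
split=> [[quasiQ idem medial penta] | [add_str [phi [auto _ mulE p0]]]].
  case: Q_nonempty => o.
  have [add_str [phi [psi [bij_phi o0 phiE mul_phi_psi]]]] :=
    medial_idempotent_quasigroup_affine o quasiQ idem medial.
  have mulE x y : (x * y)%g = phi x + (idfun \- phi) y.
    suff -> : (idfun \- phi) y = psi y by [].
    by apply/eqP; rewrite /= subr_eq addrC -mul_phi_psi idem.
  exists add_str, phi; split=> // [x phi_x | x].
    have [[t [_ t_uniq]] _] := quasiQ x x.
    by rewrite o0 -(t_uniq x (idem x)) (t_uniq o) // -phiE.
  (* At y = 0 the pentagonal law reads p(phi)(x) = 0. *)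
  have poly0 : pentagonal_poly phi 0 = 0.
    by rewrite /pentagonal_poly /= !raddf0 !(subr0, addr0).
  by have := penta x o; rewrite !mulE pentagonal_polyE -o0 poly0 subr0 addr0.
have p0' : pentagonal_poly phi =1 \0 := p0.
have bij_psi : bijective (idfun \- phi) by apply: pentagonal_poly_inverse.
split.
- exact: affine_quasigroup auto bij_psi mulE.
- by move=> x; rewrite mulE /= addrC subrK.
- move=> x y z u; rewrite !mulE /= !(raddfD, raddfN) /=.
  by rewrite [LHS](AC ((1*2)*((1*2)*(1*2))) ((1*(4*7))*((2*(5*6))*(3*(8*9))))).
- by move=> x y; rewrite !mulE pentagonal_polyE !p0' add0r subr0.
Qed.
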